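(* Let $\Sigma$ be an oriented surface. Every homologically $A$-adequate link diagram on $\Sigma$ is $A$-adequate, and every homologically $B$-adequate link diagram on $\Sigma$ is $B$-adequate.
   Context: $\Sigma$ is an oriented surface with one or more connected components, possibly with boundary. Each crossing of a link diagram $D$ on $\Sigma$ has an $A$-smoothing (which joins the two local regions swept out when the overstrand is rotated counterclockwise until it meets the understrand) and a $B$-smoothing (joining the other two local regions). A state $S$ of $D$ is a choice of smoothing at each crossing; it is identified with the resulting collection of pairwise disjoint simple loops on $\Sigma$. $S_A$ and $S_B$ are the states with all $A$-smoothings, respectively all $B$-smoothings. Two states are adjacent if they differ at exactly one crossing. $t(S)$ is the number of contractible loops of $S$, and $\widehat S$ is $S$ with its contractible loops removed, regarded as an element of $\mathcal{MC}(\Sigma)$, the set of isotopy classes of collections (possibly empty) of pairwise disjoint, non-contractible, unoriented simple loops on $\Sigma$. For a state $S$, $k(S)$ is the rank of the kernel of $i_*\colon H_1(S;\mathbb Z/2)\to H_1(\Sigma;\mathbb Z/2)$. $D$ is $A$-adequate if for every state $S$ adjacent to $S_A$ one has $t(S)\le t(S_A)$ or $\widehat S\ne\widehat S_A$ in $\mathcal{MC}(\Sigma)$. $D$ is $B$-adequate if for every state $S$ adjacent to $S_B$ one has $t(S)\le t(S_B)$ or $\widehat S\ne\widehat S_B$. $D$ is homologically $A$-adequate if $k(S)\le k(S_A)$ for every state $S$ adjacent to $S_A$, and homologically $B$-adequate if $k(S)\le k(S_B)$ for every state $S$ adjacent to $S_B$. *)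

(* Defs.v *)
From HB Require Import structures.
From mathcomp Require Import finmap freeg.
From mathcomp Require Import all_boot all_order all_algebra.
From mathcomp Require Import all_classical all_reals all_analysis.
Set Implicit Arguments.
Unset Strict Implicit.
Unset Printing Implicit Defensive.
Import Order.TTheory GRing.Theory Num.Theory numFieldNormedType.Exports.
Local Open Scope classical_set_scope.
Local Open Scope ring_scope.

Definition simplex_set (R : realType) (n : nat) : set 'rV[R]_n.+1 :=
  [set x | (forall i, 0 <= x 0 i) /\ \sum_i x 0 i = 1].

Definition simplex (R : realType) (n : nat) : topologicalType :=
  set_type (@simplex_set R n).

Definition face_row (R : realType) (n : nat) (i : 'I_n.+2) (x : 'rV[R]_n.+1) :
  'rV[R]_n.+2 := \row_j (if unlift i j is Some k then x 0 k else 0).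

Lemma face_rowP (R : realType) (n : nat) (i : 'I_n.+2) (x : simplex R n) :
  face_row i (set_val x) \in @simplex_set R n.+1.
Proof.
have /= [x0 x1] := set_valP x; apply/mem_set; split=> [j|].
  by rewrite mxE; case: unlift => [k|].
rewrite (bigD1_ord i) //= mxE unlift_none add0r -x1; apply: eq_bigr => k _.
by rewrite mxE liftK.
Qed.

Definition face_fun (R : realType) (n : nat) (i : 'I_n.+2) (x : simplex R n) :
  simplex R n.+1 :=
  exist (fun y => y \in @simplex_set R n.+1) _ (face_rowP i x).

Lemma face_continuous (R : realType) (n : nat) (i : 'I_n.+2) :
  continuous (@face_fun R n i).
Proof.
apply: continuous_comp_initial => x.
apply: (@continuous_comp _ _ _ _ (face_row i)); first exact: initial_continuous.
move=> U [P Pn PU]; rewrite /= nbhs_filterE.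
exists (fun (a : 'I_1) (k : 'I_n.+1) => P a (lift i k)) => [a k|y /= Py].
  by have := Pn a (lift i k); rewrite mxE liftK ord1.
apply: PU => a j; rewrite mxE.
case: unliftP (Pn a j) (Py a) => [k ->|->] Pj Pk; first by rewrite -(ord1 a).
by have := nbhs_singleton Pj; rewrite mxE unlift_none.
Qed.

Definition face (R : realType) (n : nat) (i : 'I_n.+2) :
  continuousType (simplex R n) (simplex R n.+1) := mkcts (@face_continuous R n i).

Definition chain (R : realType) (F : fieldType) (X : topologicalType) (n : nat)
  : lmodType F := {freeg (continuousType (simplex R n) X) / F}.

Definition boundary (R : realType) (F : fieldType) (X : topologicalType)
    (n : nat) : chain R F X n.+1 -> chain R F X n :=
  fglift (fun s : continuousType (simplex R n.+1) X =>
    \sum_(i < n.+2) (-1) ^+ i *: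
      (<< (s \o face R i : continuousType (simplex R n) X) >> : chain R F X n)).

Definition chain_map (R : realType) (F : fieldType) (X Y : topologicalType)
    (f : continuousType X Y) (n : nat) : chain R F X n -> chain R F Y n :=
  fglift (fun s : continuousType (simplex R n) X =>
    (<< (f \o s : continuousType (simplex R n) Y) >> : chain R F Y n)).

(* The dimension of the quotient [K / B] of two subspaces [B `<=` K] of [V]: the
   classes of the family [b] form a basis of the quotient.  It is 0 by
   convention if [K / B] has no finite basis. *)
Definition quotient_dim (F : fieldType) (V : lmodType F) (K B : set V) : nat :=
  xget 0%N [set n | exists b : 'I_n -> V, (forall i, K (b i)) /\
    forall z, K z -> exists! a : 'rV[F]_n, B (z - \sum_i a 0 i *: b i)].

(* The kernel of [f_* : H_1(X; F) -> H_1(Y; F)] is the quotient, by the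
   1-boundaries of [X], of the space of 1-cycles of [X] that become boundaries
   in [Y]. *)
Definition H1_kernel_rank (R : realType) (F : fieldType) (X Y : topologicalType)
    (f : continuousType X Y) : nat :=
  quotient_dim
    [set z : chain R F X 1 | boundary z = 0 /\
       range (@boundary R F Y 1) (chain_map f z)]
    (range (@boundary R F X 1)).

Definition inclusion (X : topologicalType) (A : set X) :
  continuousType (set_type A) X :=
  mkcts (@initial_continuous (set_type A) X set_val).

(* The path [g], which is meant to have period [2 pi], runs around [q] exactly
   once, counterclockwise. *)
Definition winds_once (R : realType) (g : R -> R * R) (q : R * R) : Prop :=
  exists alpha rho : R -> R,
    [/\ continuous alpha,
        forall t, 0 < rho t,
        forall t, g t = (q.1 + rho t * cos (alpha t), q.2 + rho t * sin (alpha t))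
      & alpha (pi *+ 2) = alpha 0 + pi *+ 2].

(* Orientation-preserving, for a continuous injective map that need not be
   differentiable.  On a half-plane domain, only interior points are tested. *)
Definition orientation_preserving (R : realType) (W : set (R * R))
    (f : R * R -> R * R) : Prop :=
  forall (p : R * R) (r : R), 0 < r ->
    [set q : R * R | (q.1 - p.1) ^+ 2 + (q.2 - p.2) ^+ 2 <= r ^+ 2] `<=` W ->
    winds_once (fun t => f (p.1 + r * cos t, p.2 + r * sin t)) (f p).

Record chart (R : realType) (T : topologicalType) := Chart {
  chart_dom : set T;
  chart_map : T -> R * R;
  chart_inv : R * R -> T;
  chart_open : open chart_dom;
  chart_image : exists2 V : set (R * R), open V &
    chart_map @` chart_dom = V `&` [set p | 0 <= p.2];
  chart_mapK : {in chart_dom, cancel chart_map chart_inv};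
  chart_map_continuous : {within chart_dom, continuous chart_map};
  chart_inv_continuous :
    {within chart_map @` chart_dom, continuous chart_inv}
}.

(* Topological 2-manifolds with boundary, possibly disconnected or noncompact,
   with an atlas of half-plane charts whose transition maps preserve
   orientation. *)
Record oriented_surface (R : realType) := OrientedSurface {
  surface_space :> topologicalType;
  surface_nonempty : [set: surface_space] !=set0;
  surface_hausdorff : hausdorff_space surface_space;
  surface_second_countable : @second_countable surface_space;
  atlas : set (chart R surface_space);
  atlas_cover : forall x, exists2 u, atlas u & chart_dom u x;
  atlas_oriented : forall u v, atlas u -> atlas v ->
    orientation_preserving (chart_map u @` (chart_dom u `&` chart_dom v))
      (chart_map v \o chart_inv u)
}.

Definition surface_interior (R : realType) (Sigma : oriented_surface R) :
  set Sigma :=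
  [set x | exists u, [/\ atlas u, chart_dom u x & 0 < (chart_map u x).2]].

Definition simple_loop (R : realType) (T : topologicalType) (C : set T) : Prop :=
  exists g : R -> T, [/\ continuous g,
    forall s t, g s = g t <-> s - t \is a Num.int & range g = C].

Definition contractible (R : realType) (T : topologicalType) (C : set T) : Prop :=
  exists (H : R -> T -> T) (p : T),
    [/\ {within `[0, 1] `*` C, continuous (fun q : R * T => H q.1 q.2)},
        forall x, C x -> H 0 x = x & forall x, C x -> H 1 x = p].

Definition homeomorphism (T : topologicalType) (f : T -> T) : Prop :=
  exists g, [/\ continuous f, continuous g, cancel f g & cancel g f].

(* Collections of loops are sets of loops, and isotopy is ambient isotopy. *)
Definition isotopic (R : realType) (T : topologicalType) (L L' : set (set T)) :
  Prop :=
  exists H : R -> T -> T,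
    [/\ {within `[0, 1] `*` setT, continuous (fun q : R * T => H q.1 q.2)},
        forall t, `[0, 1]%classic t -> homeomorphism (H t),
        forall x, H 0 x = x
      & [set H 1 @` C | C in L] = L'].

Definition square (R : realType) : set (R * R) :=
  [set p | `|p.1| <= 1 /\ `|p.2| <= 1].

Definition open_square (R : realType) : set (R * R) :=
  [set p | `|p.1| < 1 /\ `|p.2| < 1].

Definition oriented_disc (R : realType) (Sigma : oriented_surface R)
    (e : R * R -> Sigma) : Prop :=
  [/\ {within @square R, continuous e},
      set_inj (@square R) e,
      e @` @square R `<=` @surface_interior R Sigma,
      open (e @` @open_square R)
    & forall u, atlas u -> orientation_preserving
        (@square R `&` e @^-1` chart_dom u) (chart_map u \o e)].

(* The underlying 4-valent graph of a link diagram: a compact subset of the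
   interior of the surface which looks like the [x]-axis near every point, except
   at finitely many crossings, where it looks like the union of the two axes.
   The over/under information is carried by the coordinates at the crossing: the
   overstrand is the [x]-axis and the understrand is the [y]-axis. *)
Record link_diagram (R : realType) (Sigma : oriented_surface R) := LinkDiagram {
  graph : set Sigma;
  num_crossings : nat;
  crossing_disc : 'I_num_crossings -> R * R -> Sigma;
  graph_compact : compact graph;
  crossing_oriented : forall c, oriented_disc (crossing_disc c);
  crossing_graph : forall c p, square p ->
    graph (crossing_disc c p) <-> p.1 = 0 \/ p.2 = 0;
  crossing_disjoint : forall c c', c != c' ->
    (crossing_disc c @` @square R) `&` (crossing_disc c' @` @square R) = set0;
  graph_arc : forall x, graph x -> (forall c, x <> crossing_disc c (0, 0)) ->
    exists e : R * R -> Sigma, [/\ oriented_disc e, e (0, 0) = x &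
      forall p, square p -> graph (e p) <-> p.2 = 0]
}.

Variant smoothing := Asmoothing | Bsmoothing.

(* The [x]-axis, rotated counterclockwise until it meets the [y]-axis, sweeps out
   the quadrants where [x * y > 0].  The A-smoothing joins them, and hence
   consists of two segments in the other two quadrants. *)
Definition smoothing_arcs (R : realType) (m : smoothing) : set (R * R) :=
  match m with
  | Asmoothing => [set p | `|p.1 - p.2| = 1 /\ p.1 * p.2 <= 0]
  | Bsmoothing => [set p | `|p.1 + p.2| = 1 /\ 0 <= p.1 * p.2]
  end.

Definition smoothed (R : realType) (Sigma : oriented_surface R)
    (D : link_diagram Sigma) (s : 'I_(num_crossings D) -> smoothing) :
  set Sigma :=
  (graph D `\` \bigcup_c (@crossing_disc _ _ D c @` @square R)) `|`
  \bigcup_c (@crossing_disc _ _ D c @` @smoothing_arcs R (s c)).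

(* The loops are determined by the choice of smoothings, since they are the
   connected components of the smoothed diagram. *)
Record state (R : realType) (Sigma : oriented_surface R)
    (D : link_diagram Sigma) := State {
  choice_of : 'I_(num_crossings D) -> smoothing;
  loops : set (set Sigma);
  loops_finite : finite_set loops;
  loops_simple : forall C, loops C -> simple_loop R C;
  loops_disjoint : trivIset loops id;
  loops_cover : \bigcup_(C in loops) C = smoothed choice_of
}.

Section StateInvariants.
Context (R : realType) (Sigma : oriented_surface R) (D : link_diagram Sigma).
Implicit Types (S : state D) (m : smoothing).

Definition adjacent S S' : Prop :=
  exists c, forall c', choice_of S c' <> choice_of S' c' <-> c' = c.

Definition is_all_state m S : Prop := forall c, choice_of S c = m.

Definition num_contractible S : nat :=
  #|` fset_set [set C | loops S C /\ contractible R C]|%fset.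

Definition noncontractible_loops S : set (set Sigma) :=
  [set C | loops S C /\ ~ contractible R C].

Definition kernel_rank S : nat :=
  H1_kernel_rank R 'F_2 (inclusion (\bigcup_(C in loops S) C)).

End StateInvariants.

Definition adequate (R : realType) (Sigma : oriented_surface R)
    (D : link_diagram Sigma) (m : smoothing) : Prop :=
  forall Sm S : state D, is_all_state m Sm -> adjacent S Sm ->
    (num_contractible S <= num_contractible Sm)%N \/
    ~ isotopic R (noncontractible_loops S) (noncontractible_loops Sm).

Definition homologically_adequate (R : realType) (Sigma : oriented_surface R)
    (D : link_diagram Sigma) (m : smoothing) : Prop :=
  forall Sm S : state D, is_all_state m Sm -> adjacent S Sm ->
    (kernel_rank S <= kernel_rank Sm)%N.

(* Main.v *)
Require Import Defs.
From HB Require Import structures.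
From mathcomp Require Import finmap freeg.
From mathcomp Require Import all_boot all_order all_algebra.
From mathcomp Require Import all_classical all_reals all_analysis.
From mathcomp Require Import lra zify.
Set Implicit Arguments.
Unset Strict Implicit.
Unset Printing Implicit Defensive.
Import Order.TTheory GRing.Theory Num.Theory numFieldNormedType.Exports.
Local Open Scope classical_set_scope.
Local Open Scope ring_scope.

(** The proof counts dimensions.  The classes of the loops of a state [S] form
    a basis of its first homology, so the kernel of the map induced by the
    inclusion is the space of linear relations between the classes of these
    loops in the surface.  A contractible loop bounds, hence its coefficient in
    a relation is free, and

      [k(S) = t(S) + dim W]

    where [W] is the space of relations between the noncontractible loops
    ([kernel_rank_split]).  An ambient isotopy deforms each loop by a homotopy
    and so does not change [W].  If the noncontractible loops of [S] and of the
    all-[A] state [S_A] are isotopic, then [k(S) - k(S_A) = t(S) - t(S_A)], and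
    [k(S) <= k(S_A)] gives [t(S) <= t(S_A)].  The same count applies
    to [S_B].

    The basis of the homology of a finite disjoint union of loops is found with
    singular chains ([H1_kernel_rank_loops]).  A singular simplex lies in one
    loop, because simplices are connected, and lifts through the
    parametrization of this loop by the line, because simplices are compact and
    contractible ([homotopy_lift], [lift_exists]).  The change of the integer
    part of the lift along an edge defines a cocycle, the winding number, with
    one component for each loop.  It takes the value 1 on a loop run once, so
    the loops are independent.  They generate because the line is contractible:
    a lifted edge can be straightened, cut at 0 and at integers, and what
    remains depends only on the ends of the edge, so that it cancels in a cycle
    ([loop_decomposition]). *)

(** * Dimensions of quotients of subspaces *)

Definition submodule (F : fieldType) (V : lmodType F) (B : set V) : Prop :=
  B 0 /\ forall a u v, B u -> B v -> B (a *: u + v).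

Definition quotient_basis (F : fieldType) (V : lmodType F) (K B : set V)
    (n : nat) (b : 'I_n -> V) : Prop :=
  (forall i, K (b i)) /\
  forall z, K z -> exists! a : 'rV[F]_n, B (z - \sum_i a 0 i *: b i).

(** The dimension is a quotient by the null space, so that it can be compared
    directly with the rank of a kernel in homology. *)
Definition subspace_dim (F : fieldType) (V : lmodType F) (W : set V) : nat :=
  quotient_dim W [set 0 : V].

Section Submodule.
Context (F : fieldType) (V : lmodType F) (B : set V).
Hypothesis subB : submodule B.

Lemma submodule0 : B 0. Proof. by case: subB. Qed.

Lemma submoduleZ a u : B u -> B (a *: u).
Proof.
by move=> Bu; rewrite -[_ *: _]addr0; apply: subB.2 => //; case: subB.
Qed.

Lemma submoduleD u v : B u -> B v -> B (u + v).
Proof. by move=> Bu Bv; rewrite -[u]scale1r; apply: subB.2. Qed.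

Lemma submoduleN u : B u -> B (- u).
Proof. by rewrite -scaleN1r; apply: submoduleZ. Qed.

Lemma submoduleB u v : B u -> B v -> B (u - v).
Proof. by move=> Bu Bv; apply: submoduleD => //; apply: submoduleN. Qed.

Lemma submodule_sum (I : Type) (r : seq I) (P : pred I) (E : I -> V) :
  (forall i, P i -> B (E i)) -> B (\sum_(i <- r | P i) E i).
Proof.
by move=> BE; apply: big_ind => //; [exact: submodule0|exact: submoduleD].
Qed.

Lemma submodule_trans v u w : B (u - v) -> B (v - w) -> B (u - w).
Proof. by move=> uv vw; rewrite -(subrKA v); apply: submoduleD. Qed.

(** Writing each basis in terms of the other gives two matrices, whose product
    is the identity because coordinates modulo [B] are unique. *)
Lemma quotient_basis_le (K : set V) n m (b : 'I_n -> V) (b' : 'I_m -> V) :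
  quotient_basis K B b -> quotient_basis K B b' -> (n <= m)%N.
Proof.
move=> [Kb gen] [Kb' gen'].
have /choice[A AE] i : exists a : 'rV[F]_m, B (b i - \sum_j a 0 j *: b' j).
  by have [a [? _]] := gen' _ (Kb i); exists a.
have /choice[A' A'E] i : exists a : 'rV[F]_n, B (b' i - \sum_j a 0 j *: b j).
  by have [a [? _]] := gen _ (Kb' i); exists a.
pose M := \matrix_(i, j) A i 0 j; pose M' := \matrix_(i, j) A' i 0 j.
apply: (@mulmx1_min _ _ _ M M'); apply/row_matrixP => i.
have [a [_ aE]] := gen _ (Kb i).
transitivity a; last first.
  apply: aE; rewrite row1; under eq_bigr => j do rewrite mxE eqxx /=.
  rewrite (bigD1 i)//= eqxx scale1r big1 ?addr0 ?subrr; first exact: submodule0.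
  by move=> j /negPf ->; rewrite scale0r.
apply/esym/aE/(submodule_trans (AE i)).
suff -> : \sum_j (row i (M *m M')) 0 j *: b j =
          \sum_j A i 0 j *: \sum_k A' j 0 k *: b k.
  rewrite -sumrB; apply: submodule_sum => j _.
  by rewrite -scalerBr; apply: submoduleZ.
under [RHS]eq_bigr => j do rewrite scaler_sumr.
rewrite exchange_big /=; apply: eq_bigr => j _.
rewrite !mxE scaler_suml; apply: eq_bigr => k _.
by rewrite !mxE scalerA.
Qed.

Lemma quotient_dimE (K : set V) n (b : 'I_n -> V) :
  quotient_basis K B b -> quotient_dim K B = n.
Proof.
move=> basis_b; rewrite /quotient_dim.
case: xgetP => [m _ [b' basis_b']|/(_ n)[]]; last by exists b.
by apply/eqP; rewrite eqn_leq !(quotient_basis_le basis_b basis_b',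
  quotient_basis_le basis_b' basis_b).
Qed.

End Submodule.

Lemma submodule_set0 (F : fieldType) (V : lmodType F) :
  submodule [set 0 : V].
Proof. by split=> // a u v -> ->; rewrite scaler0 addr0. Qed.

(** Membership in [W] is a mere proposition, so there is no matrix to start
    from: a matrix of maximal rank among those with rows in [W] is chosen. *)
Lemma submodule_rowspace (F : fieldType) n (W : set 'rV[F]_n) : submodule W ->
  exists k (N : 'M[F]_(k, n)), row_free N /\ forall a, W a <-> (a <= N)%MS.
Proof.
move=> subW.
pose P r := `[< exists N : 'M[F]_n,
  (forall a : 'rV_n, (a <= N)%MS -> W a) /\ \rank N = r >].
have exP : exists r, P r.
  exists 0%N; apply/asboolP; exists 0; split; last exact: mxrank0.
  by move=> a; rewrite submx0 => /eqP ->; case: subW.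
have ubP r : P r -> (r <= n)%N.
  by move=> /asboolP[N [_ <-]]; exact: rank_leq_row.
case: (ex_maxnP exP ubP) => r /asboolP[N [NW rN]] maxr.
exists (\rank N), (row_base N); split=> [|a]; first exact: row_base_free.
rewrite eq_row_base; split=> [Wa|/NW//].
have /maxr : P (\rank (N + a)%MS).
  apply/asboolP; exists (N + a)%MS; split=> // x /sub_addsmxP[[u v] ->] /=.
  apply: (submoduleD subW); first by apply: NW; exact: submxMl.
  have -> : v *m a = v 0 0 *: a by rewrite {1}[v]mx11_scalar mul_scalar_mx.
  exact: submoduleZ.
rewrite -rN => rank_le.
have : (N + a <= N)%MS.
  by rewrite -(geq_leqif (mxrank_leqif_sup (addsmxSl N a))).
by apply: submx_trans; exact: addsmxSr.
Qed.

Lemma quotient_basis_row (F : fieldType) n k (N : 'M[F]_(k, n))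
    (W : set 'rV[F]_n) : row_free N -> (forall a, W a <-> (a <= N)%MS) ->
  quotient_basis W [set 0 : 'rV[F]_n] (fun i => row i N).
Proof.
move=> freeN WN; split=> [i|z /WN/submxP[a ->]]; first exact/WN/row_sub.
exists a; split=> [|a' /=]; rewrite -mulmx_sum_row ?subrr// => /eqP.
by rewrite subr_eq0 => /eqP; exact: row_free_inj.
Qed.

(** For contractible loops: they bound, so their coefficients in a relation are
    arbitrary. *)
Lemma quotient_dim_free (F : fieldType) n t (W : set 'rV[F]_n)
    (W' : set 'rV[F]_(n + t)) : submodule W ->
  (forall a, W' a <-> W (lsubmx a)) ->
  subspace_dim W' = (subspace_dim W + t)%N.
Proof.
move=> subW W'E; have [k [N [freeN WN]]] := submodule_rowspace subW.
rewrite /subspace_dim (quotient_dimE (@submodule_set0 _ _)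
  (quotient_basis_row freeN WN)).
apply: (quotient_dimE (@submodule_set0 _ _)
  (@quotient_basis_row _ _ _ (block_mx N 0 0 1%:M) _ _ _)).
  by rewrite /row_free rank_diag_block_mx mxrank1 (eqP freeN).
move=> a; rewrite W'E WN; split=> /submxP[d dE].
  apply/submxP; exists (row_mx d (rsubmx a)).
  by rewrite mul_row_block !mulmx0 mulmx1 addr0 add0r -dE hsubmxK.
apply/submxP; exists (lsubmx d).
by rewrite dE -[d in LHS]hsubmxK mul_row_block mulmx0 addr0 row_mxKl.
Qed.

(** The families [c] and [deg] are mutually inverse between [W] and the
    quotient [K / B]: the cycles [c] and the dual cocycles [deg] compute a
    homology group. *)
Lemma quotient_dim_transfer (F : fieldType) (V : lmodType F) (K B : set V) n
    (c : 'I_n -> V) (deg : {linear V -> 'rV[F]_n}) (W : set 'rV[F]_n) :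
  submodule B -> submodule W ->
  (forall z, B z -> deg z = 0) ->
  (forall i, deg (c i) = delta_mx 0 i) ->
  (forall z, K z -> B (z - \sum_i deg z 0 i *: c i) /\ W (deg z)) ->
  (forall a, W a -> K (\sum_i a 0 i *: c i)) ->
  quotient_dim K B = subspace_dim W.
Proof.
move=> subB subW degB degc KB WK.
have degK (a : 'rV[F]_n) : deg (\sum_i a 0 i *: c i) = a.
  rewrite linear_sum [RHS](row_sum_delta a); apply: eq_bigr => i _.
  by rewrite linearZ /= degc.
have [k [N [freeN WN]]] := submodule_rowspace subW.
have basisN := quotient_basis_row freeN WN.
rewrite /subspace_dim (quotient_dimE (@submodule_set0 _ _) basisN).
have combE (a : 'rV_k) : \sum_i a 0 i *: \sum_j (row i N) 0 j *: c j =
    \sum_j (a *m N) 0 j *: c j.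
  under eq_bigr => i do rewrite scaler_sumr.
  rewrite exchange_big /=; apply: eq_bigr => j _.
  rewrite !mxE scaler_suml; apply: eq_bigr => i _.
  by rewrite !mxE scalerA.
apply: (quotient_dimE subB
  (b := fun i => \sum_j (row i N) 0 j *: c j)); split=> [i|z Kz].
  by apply: WK; exact: basisN.1.
have [Bz Wz] := KB _ Kz; have /WN/submxP[a aE] := Wz.
exists a; split=> [|a']; rewrite combE -?aE// => /degB.
move=> /eqP; rewrite linearB /= degK subr_eq0 aE => /eqP; exact: row_free_inj.
Qed.

(** * Topology of the standard simplices *)

Lemma clopen_line (R : realType) (A : set R) (t : R) :
  open A -> closed A -> A t -> forall u, A u.
Proof.
move=> oA cA At u; suff -> : A = setT by [].
have : connected [set: R] by apply/connected_intervalP.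
by apply; [exists t|exists A; rewrite ?setTI..].
Qed.

(** Homotopies are given on the unit interval only; clamping the time extends
    them continuously to the whole line. *)
Definition unit_clamp (R : realType) (t : R) : R := Num.max 0 (Num.min t 1).

Lemma unit_clamp_itv (R : realType) (t : R) : 0 <= unit_clamp t <= 1.
Proof. by rewrite /unit_clamp le_max lexx /= ge_max ler01 ge_min lexx orbT. Qed.

Lemma unit_clamp_id (R : realType) (t : R) : 0 <= t <= 1 -> unit_clamp t = t.
Proof. by move=> /andP[t0 t1]; rewrite /unit_clamp min_l// max_r. Qed.

Lemma unit_clamp_continuous (R : realType) : continuous (@unit_clamp R).
Proof.
move=> t; have min_cts : {for t, continuous ((idfun : R -> R^o) \min cst 1)}.
  apply: (@continuous_min R R idfun (cst 1) t); first exact: cvg_id.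
  exact: cvg_cst.
apply: (@continuous_max R R (cst 0 : R -> R^o) _ t); last exact: min_cts.
exact: cvg_cst.
Qed.

Lemma continuous_bigsum (R : realType) (E : normedModType R)
    (T : topologicalType) (I : Type) (r : seq I) (f : I -> T -> E) :
  (forall i, continuous (f i)) -> continuous (fun x => \sum_(i <- r) f i x).
Proof.
move=> fc; elim: r => [|i r IH].
  have -> : (fun x : T => \sum_(i <- [::]) f i x) = cst 0.
    by apply/funext => x; rewrite big_nil.
  by move=> x; exact: cvg_cst.
have -> : (fun x => \sum_(j <- i :: r) f j x) =
    f i \+ (fun x => \sum_(j <- r) f j x).
  by apply/funext => x; rewrite big_cons.
by move=> x; apply: continuousD; [exact: fc|exact: IH].
Qed.

Section Simplex.
Context (R : realType) (n : nat).
Implicit Types T : topologicalType.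

Definition barycentric (i : 'I_n.+1) (x : simplex R n) : R :=
  (set_val x : 'rV_n.+1) 0 i.

Lemma barycentric_ge0 i (x : simplex R n) : 0 <= barycentric i x.
Proof. by have /= [x0 _] := set_valP x; exact: x0. Qed.

Lemma barycentric_sum (x : simplex R n) : \sum_i barycentric i x = 1.
Proof. by have /= [_ x1] := set_valP x. Qed.

Lemma barycentric_le1 i (x : simplex R n) : barycentric i x <= 1.
Proof.
rewrite -(barycentric_sum x) (bigD1 i)//= lerDl sumr_ge0// => j _.
exact: barycentric_ge0.
Qed.

Lemma simplex_eq (x y : simplex R n) :
  (forall i, barycentric i x = barycentric i y) -> x = y.
Proof.
by move=> xy; apply: val_inj; apply/rowP => i; exact: xy.
Qed.

Lemma barycentric_continuous i : continuous (barycentric i).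
Proof.
move=> x.
apply: (@continuous_comp _ _ _ set_val (fun M : 'rV[R]_n.+1 => M 0 i)).
  exact: initial_continuous.
exact: coord_continuous.
Qed.

Lemma rV_continuous T m (f : T -> 'rV[R]_m) :
  (forall i, continuous (fun x => f x 0 i)) -> continuous f.
Proof.
move=> fc x U [P Pn PU]; rewrite /= nbhs_filterE.
have : \forall y \near x, forall i : 'I_m, P 0 i (f y 0 i).
  by apply: filter_forall => i; apply: (fc i); exact: Pn.
apply: filterS => y Py; apply: PU => a j; rewrite ord1; exact: Py.
Qed.

Definition simplex_point (a : 'I_n.+1 -> R)
    (a_ge0 : forall i, 0 <= a i) (a_sum : \sum_i a i = 1) : simplex R n.
Proof.
exists (\row_i a i); apply/mem_set; split=> [i|]; first by rewrite mxE.
by rewrite -a_sum; apply: eq_bigr => i _; rewrite mxE.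
Defined.

Lemma barycentric_point a a_ge0 a_sum i :
  barycentric i (@simplex_point a a_ge0 a_sum) = a i.
Proof. by rewrite /barycentric /= mxE. Qed.

Lemma simplex_continuous T (f : T -> simplex R n) :
  (forall i, continuous (barycentric i \o f)) -> continuous f.
Proof.
by move=> fc; apply: continuous_comp_initial; apply: rV_continuous.
Qed.

Lemma simplex_compact : compact [set: simplex R n].
Proof.
have cK : compact (@simplex_set R n).
  apply: bounded_closed_compact.
    exists 1; split; first exact: num_real.
    move=> e e1 x [x0 x1]; rewrite /Num.norm /= mx_normrE.
    apply: (le_trans _ (ltW e1)); apply/bigmax_leP; split=> // -[i j] _ /=.
    rewrite ord1 ger0_norm// -x1 (bigD1 j)//= lerDl sumr_ge0//.
  have -> : @simplex_set R n =
      (\bigcap_(i in [set: 'I_n.+1]) [set x : 'rV_n.+1 | 0 <= x 0 i]) `&`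
      [set x : 'rV_n.+1 | \sum_i x 0 i = 1].
    by apply/seteqP; split=> x [x0 x1]; split=> // i; [move=> _; exact: x0|
      exact: (x0 i I)].
  apply: closedI.
    apply: closed_bigI => i _.
    apply: (@preimage_closed _ _ (fun x : 'rV[R]_n.+1 => x 0 i)
      [set t | 0 <= t]).
      by move=> x _; exact: coord_continuous.
    exact: closed_ge.
  apply: (@preimage_closed _ _ (fun x : 'rV[R]_n.+1 => \sum_i x 0 i)
    [set t | t = 1]).
    by move=> x _; apply: (@continuous_bigsum R R^o) => i;
      exact: coord_continuous.
  exact: closed_eq.
move=> F PF _.
have PF' : ProperFilter ((set_val : simplex R n -> 'rV_n.+1) @ F).
  exact: fmap_proper_filter.
have [|p [Kp clp]] := cK ((set_val : simplex R n -> 'rV_n.+1) @ F) PF'.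
  have : \forall x \near F, simplex_set (set_val (x : simplex R n)).
    by apply: filterE => x; exact: set_valP.
  by [].
exists (exist _ p (mem_set Kp)); split=> // A U FA [V [ [W oW <-] Wp WU]].
have [|q []] := clp (set_val @` A) W _ (open_nbhs_nbhs (conj oW Wp)).
  suff : F (set_val @^-1` (set_val @` A)) by [].
  by apply: (@filterS _ F _ A) => // x Ax; exists x.
by move=> [x Ax <-] Wx; exists x; split=> //; apply: WU.
Qed.

End Simplex.

Lemma continuous_pair (T U V : topologicalType) (f : T -> U) (g : T -> V) :
  continuous f -> continuous g -> continuous (fun x => (f x, g x)).
Proof. by move=> fc gc x; exact: (cvg_pair (fc x) (gc x)). Qed.

Section SimplexShrink.
Context (R : realType) (n : nat).

Definition vertex (i : 'I_n.+1) : simplex R n.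
Proof.
apply: (@simplex_point R n (fun j => (j == i)%:R)) => [j|]; first exact: ler0n.
by rewrite (bigD1 i)//= eqxx big1 ?addr0// => j /negPf ->.
Defined.

Lemma barycentric_vertex (i j : 'I_n.+1) :
  barycentric j (vertex i) = (j == i)%:R.
Proof. exact: barycentric_point. Qed.

(** The straight-line contraction to the first vertex. *)
Definition shrink_coord (p : R * simplex R n) (i : 'I_n.+1) : R :=
  (1 - unit_clamp p.1) * barycentric i (vertex ord0) +
  unit_clamp p.1 * barycentric i p.2.

Lemma shrink_coord_ge0 p i : 0 <= shrink_coord p i.
Proof.
have /andP[c0 c1] := unit_clamp_itv p.1.
by rewrite addr_ge0 ?mulr_ge0 ?subr_ge0 ?barycentric_ge0.
Qed.

Lemma shrink_coord_sum p : \sum_i shrink_coord p i = 1.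
Proof. by rewrite big_split /= -!mulr_sumr !barycentric_sum !mulr1 subrK. Qed.

Definition shrink (p : R * simplex R n) : simplex R n :=
  simplex_point (shrink_coord_ge0 p) (shrink_coord_sum p).

Lemma barycentric_shrink i p : barycentric i (shrink p) =
  (1 - unit_clamp p.1) * barycentric i (vertex ord0) +
  unit_clamp p.1 * barycentric i p.2.
Proof. exact: barycentric_point. Qed.

Lemma shrink0 x : shrink (0, x) = vertex ord0.
Proof.
apply: simplex_eq => i.
rewrite barycentric_shrink /= unit_clamp_id ?lexx ?ler01//.
by rewrite subr0 mul1r mul0r addr0.
Qed.

Lemma shrink1 x : shrink (1, x) = x.
Proof.
apply: simplex_eq => i.
rewrite barycentric_shrink /= unit_clamp_id ?lexx ?ler01//.
by rewrite subrr mul1r mul0r add0r.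
Qed.

Lemma shrink_continuous : continuous shrink.
Proof.
apply: simplex_continuous => i.
have -> : barycentric i \o shrink = (fun p : R * simplex R n =>
    (1 - unit_clamp p.1) * barycentric i (vertex ord0) +
    unit_clamp p.1 * barycentric i p.2).
  by apply/funext => p; exact: barycentric_shrink.
move=> p.
have c_cts : {for p, continuous (fun p : R * simplex R n => unit_clamp p.1)}.
  by apply: continuous_comp; [exact: cvg_fst|exact: unit_clamp_continuous].
apply: cvgD; apply: cvgM.
- by apply: cvgB => //; exact: cvg_cst.
- exact: cvg_cst.
- exact: c_cts.
- by apply: continuous_comp; [exact: cvg_snd|exact: barycentric_continuous].
Qed.

(** Each point is joined to the first vertex by a path, which reduces the claim
    to the connectedness of the line. *)
Lemma clopen_simplex (A : set (simplex R n)) x :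
  open A -> closed A -> A x -> forall y, A y.
Proof.
move=> oA cA Ax.
have path_cts z : continuous (fun t => shrink (t, z)).
  move=> t; apply: (@continuous_comp _ _ _ (fun t : R => (t, z)) shrink).
    by apply: continuous_pair => u; [exact: cvg_id|exact: cvg_cst].
  exact: shrink_continuous.
have path_A z t u : A (shrink (t, z)) -> A (shrink (u, z)).
  move=> At; apply: (@clopen_line _ (fun t => A (shrink (t, z))) t) => //.
    by apply: open_comp => // s _; exact: path_cts.
  by apply: preimage_closed => // s _; exact: path_cts.
move=> y; rewrite -(shrink1 y); apply: (path_A y 0).
by rewrite shrink0 -(shrink0 x); apply: (path_A x 1); rewrite shrink1.
Qed.

(** Two lifts of a simplex differ by such a function, hence by one integer. *)
Lemma simplex_int_valued_cst (w : simplex R n -> R) : continuous w ->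
  (forall x, w x \is a Num.int) -> forall x y, w x = w y.
Proof.
move=> wc wint x y.
apply: (@clopen_simplex (fun z => w z = w y) y) => //.
  have -> : (fun z => w z = w y) = w @^-1` ball (w y) 1.
    apply/seteqP; split=> z /=; first by move=> ->; exact: ballxx.
    rewrite /ball /= => lt1; apply/eqP; rewrite eq_sym -subr_eq0.
    apply: contraTT lt1 => ne; rewrite -leNgt; apply: norm_intr_ge1 => //.
    by rewrite rpredB.
  by apply: open_comp => [s _|]; [exact: wc|exact: ball_open].
by apply: (@preimage_closed _ _ w [set t | t = w y]) => [s _|];
  [exact: wc|exact: closed_eq].
Qed.

End SimplexShrink.

(** * Lifting through a parametrization of a loop *)

Definition loop_param (R : realType) (Y : topologicalType) (g : R -> Y) :
  Prop := continuous g /\ forall s t, g s = g t <-> s - t \is a Num.int.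

Lemma int_small_eq0 (R : realType) (x : R) :
  x \is a Num.int -> `|x| < 1 -> x = 0.
Proof.
move=> xint; apply: contraTeq => x0; rewrite -leNgt; exact: norm_intr_ge1.
Qed.

Lemma int_window (R : realType) (a v : R) :
  exists v', [/\ v' - v \is a Num.int, a <= v' & v' < a + 1].
Proof.
exists (v - (Num.floor (v - a))%:~R).
have /andP[] := floor_itv (v - a); rewrite intrD => fl fu; split.
- by rewrite addrAC subrr add0r rpredN intr_int.
- by rewrite lerBrDl -lerBrDr.
- by rewrite ltrBlDl addrA (addrC _ a) -addrA -ltrBlDl.
Qed.

Section Lifting.
Context (R : realType) (Y : topologicalType) (g : R -> Y).
Hypothesis hausY : hausdorff_space Y.
Hypothesis loop_g : loop_param g.

Let g_cts : continuous g := loop_g.1.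
Let g_eq s t : g s = g t <-> s - t \is a Num.int := loop_g.2 s t.

Lemma loop_image_closed (a b : R) : closed (g @` `[a, b]).
Proof.
apply: compact_closed => //.
apply: continuous_compact; last exact: segment_compact.
exact: continuous_subspaceT.
Qed.

Lemma loop_range_closed : closed (range g).
Proof.
suff -> : range g = g @` `[0, 1] by exact: loop_image_closed.
apply/seteqP; split=> [_ [v _ <-]|_ [v _ <-]]; last by exists v.
have [w [wv w0 w1]] := int_window 0 v; exists w; last exact/g_eq.
by rewrite /= in_itv /= w0 ltW// -[1]add0r.
Qed.

(** For [d <= 1 / 2], the points that are not the image of a point at distance
    at least [d] from [a + Z]. It is open in a Hausdorff space, as the
    complement of a compact set; this replaces the local inverses of the
    covering [g]. *)
Definition arc (a d : R) : set Y := ~` (g @` `[a + d, a + 1 - d]).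

Lemma arc_nbhs (a d : R) : 0 < d -> nbhs (g a) (arc a d).
Proof.
move=> d0; apply: open_nbhs_nbhs; split.
  exact/closed_openC/loop_image_closed.
move=> [v]; rewrite /= in_itv /= => /andP[av va] /g_eq va_int.
suff : v - a = 0 by lra.
by apply: int_small_eq0 => //; rewrite ltr_norml; lra.
Qed.

Lemma arcP (a d v : R) : 0 < d -> d <= 1 / 2 -> arc a d (g v) ->
  exists v', v' - v \is a Num.int /\ `|v' - a| < d.
Proof.
move=> d0 d1 arc_v; have [v' [v'v lo hi]] := int_window (a - d) v.
exists v'; split=> //; rewrite ltNge; apply/negP => far; apply: arc_v.
have [le_v'a|lt_av'] := lerP v' a.
  exists (v' + 1).
    by move: far; rewrite ler0_norm ?subr_le0//= in_itv /= => ?; lra.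
  by apply/g_eq; rewrite addrAC; exact: rpredD (rpred1 _).
exists v'; last exact/g_eq.
by move: far; rewrite gtr0_norm ?subr_gt0//= in_itv /= => ?; lra.
Qed.

(** The lift of [f] that stays at distance less than [1 / 2] from [u] is
    unique, and this makes it continuous: near a point, [f] stays in a small
    arc, so that [v] stays close to an integer translate of its value, and the
    bound excludes all translations but the trivial one. *)
Lemma lift_near (T : topologicalType) (f : T -> Y) (u : T -> R) :
  continuous f -> continuous u ->
  (forall x, exists v, g v = f x /\ `|v - u x| < 1 / 2) ->
  exists v, continuous v /\ forall x, g (v x) = f x.
Proof.
move=> fc uc /choice[v vP]; exists v; split=> [x0|x]; last by have [] := vP x.
have [v0 near0] := vP x0.
apply/cvgrPdist_lt => e e0.
(* With [d <= h / 2], the integer [w - v x] below is smaller in absolute value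
   than [d + (1 / 2 - h) + h / 2 + 1 / 2 <= 1], so it vanishes. *)
pose h := 1 / 2 - `|v x0 - u x0|; have h0 : 0 < h by rewrite subr_gt0.
pose d := Num.min e (h / 2).
have d0 : 0 < d by rewrite lt_min e0 divr_gt0.
have de : d <= e by rewrite ge_min lexx.
have dh : d <= h / 2 by rewrite ge_min lexx orbT.
have h_le : h <= 1 / 2 by rewrite /h gerBl.
have f_near : \forall x \near x0, arc (v x0) d (f x).
  by apply: fc; rewrite -v0; exact: arc_nbhs.
have u_near : \forall x \near x0, `|u x0 - u x| < h / 2.
  by have /cvgrPdist_lt := uc x0; apply; rewrite divr_gt0.
near=> x.
have [vx near_x] := vP x.
have ux : `|u x0 - u x| < h / 2 by near: x.
have d_half : d <= 1 / 2 by lra.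
have arc_x : arc (v x0) d (g (v x)) by rewrite vx; near: x.
have [w [wint wd]] := arcP d0 d_half arc_x.
suff wv : w = v x by rewrite -wv distrC (lt_le_trans wd).
apply/eqP; rewrite -subr_eq0; apply/eqP/int_small_eq0 => //.
move: wd ux near_x dh; rewrite /h; move: near0.
rewrite !ltr_norml; case: (ger0P (v x0 - u x0)) => ?;
  move=> /andP[? ?] /andP[? ?] /andP[? ?] /andP[? ?] ?;
  by apply/andP; split; lra.
Unshelve. all: by end_near. Qed.

(** By compactness of [T], the maps [G (s, _)] and [G (t, _)] are uniformly
    close for [s] near [t], so [lift_near] transports a lift from one to the
    other. The times at which a lift exists form a set that is open and closed
    in the line. *)
Lemma homotopy_lift (T : topologicalType) (G : R * T -> Y) (u : T -> R) :
  compact [set: T] -> continuous G -> (forall p, range g (G p)) ->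
  continuous u -> (forall x, g (u x) = G (0, x)) ->
  exists v, continuous v /\ forall x, g (v x) = G (1, x).
Proof.
move=> cT Gc Gg uc uE.
pose liftable t := exists v, continuous v /\ forall x, g (v x) = G (t, x).
have G_slice t : continuous (fun x => G (t, x)).
  move=> x.
  apply: (@continuous_comp _ _ _ (fun y : T => (t, y)) G); last exact: Gc.
  by apply: continuous_pair => y; [exact: cvg_cst|exact: cvg_id].
have transfer s t : (forall x, exists a, arc a (1 / 4) (G (s, x)) /\
    arc a (1 / 4) (G (t, x))) -> liftable s -> liftable t.
  move=> close [v [vc vE]]; apply: (lift_near (G_slice t) vc) => x.
  have [a [as_ at_]] := close x.
  have [w _ wE] := Gg (t, x).
  rewrite -vE in as_; rewrite -wE in at_.
  have d0 : 0 < 1 / 4 :> R by lra.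
  have d1 : 1 / 4 <= 1 / 2 :> R by lra.
  have [p [pv pa]] := arcP d0 d1 as_; have [q [qw qa]] := arcP d0 d1 at_.
  (* [p] and [q] are representatives near [a]; translating [q] by the integer
     [v x - p] brings it near [v x]. *)
  exists (q + (v x - p)); split.
    rewrite -wE; apply/g_eq; rewrite addrAC; apply: rpredD => //.
    by rewrite -opprB rpredN.
  by move: pa qa; rewrite !ltr_norml => /andP[? ?] /andP[? ?]; lra.
have loc t : \forall s \near t, forall x, exists a,
    arc a (1 / 4) (G (s, x)) /\ arc a (1 / 4) (G (t, x)).
  have /compact_near_coveringP/(_ R (nbhs t) (fun s x => exists a,
    arc a (1 / 4) (G (s, x)) /\ arc a (1 / 4) (G (t, x)))) := cT.
  have H x : [set: T] x -> \forall x' \near x & s \near t, exists a,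
      arc a (1 / 4) (G (s, x')) /\ arc a (1 / 4) (G (t, x')).
    move=> _; have [a _ aE] := Gg (t, x).
    have arcG : nbhs (G (t, x)) (arc a (1 / 4)).
      by rewrite -aE; apply: arc_nbhs; lra.
    have [[I B] [/= tI xB] IBG] := Gc (t, x) _ arcG.
    exists (B, I) => // -[y s] /= [By Is]; exists a.
    split; first exact: (IBG (s, y)).
    by apply: (IBG (t, y)); split=> //; exact: nbhs_singleton tI.
  move=> /(_ _ H); apply: filterS => s sP x; exact: sP.
have [v [vc vE]] : liftable 1.
  apply: (@clopen_line _ liftable 0); last by exists u.
    rewrite openE => t lt; apply: filterS (loc t) => s close.
    by apply: transfer lt => x; have [a []] := close x; exists a.
  rewrite -openC openE => t nlt; apply: filterS (loc t) => s close ls.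
  apply: nlt.
  by apply: transfer ls => x; have [a []] := close x; exists a.
by exists v.
Qed.

End Lifting.

(** * Singular chains in low degrees *)

Section AffineSimplex.
Context (R : realType) (E : normedModType R) (n : nat).
Implicit Type p : 'I_n.+1 -> E.

Definition affine_fun p (x : simplex R n) : E := \sum_i barycentric i x *: p i.

Lemma affine_continuous p : continuous (affine_fun p).
Proof.
apply: continuous_bigsum => i x.
apply: (cvgZr_tmp (FF := nbhs_filter x)); exact: barycentric_continuous.
Qed.

Definition affine p : continuousType (simplex R n) E :=
  mkcts (@affine_continuous p).

Lemma affineE p x : affine p x = \sum_i barycentric i x *: p i.
Proof. by []. Qed.

Lemma affine_vertex p i : affine p (vertex R i) = p i.
Proof.
rewrite !affineE (bigD1 i)//= barycentric_vertex eqxx scale1r.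
by rewrite big1 ?addr0// => j /negPf ji; rewrite barycentric_vertex ji scale0r.
Qed.

End AffineSimplex.

Section Faces.
Context (R : realType) (n : nat).

Lemma barycentric_face (i j : 'I_n.+2) (x : simplex R n) :
  barycentric j (face R i x) =
  if unlift i j is Some k then barycentric k x else 0.
Proof. by rewrite /barycentric /= mxE. Qed.

Lemma affine_face (E : normedModType R) (p : 'I_n.+2 -> E) i x :
  affine p (face R i x) = affine (p \o lift i) x.
Proof.
rewrite !affineE (bigD1_ord i)//= barycentric_face unlift_none scale0r add0r.
by apply: eq_bigr => k _; rewrite barycentric_face liftK.
Qed.

Lemma face_vertex (i : 'I_n.+2) k : face R i (vertex R k) = vertex R (lift i k).
Proof.
apply: simplex_eq => j; rewrite barycentric_face barycentric_vertex.
case: unliftP => [l ->|->]; last by rewrite (negPf (neq_lift _ _)).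
by rewrite barycentric_vertex (inj_eq lift_inj).
Qed.

End Faces.

Section Chains.
Context (R : realType) (F : fieldType).

Lemma fglift_is_linear (K : choiceType) (M : lmodType F) (f : K -> M) :
  linear (fglift f : {freeg K / F} -> M).
Proof.
have addf : {morph (fglift f : {freeg K / F} -> M) : u v / u + v}.
  move=> u v; have subf := @lift_is_additive F K M f.
  have f0 : fglift f 0 = 0 by rewrite -(subrr 0) subf subrr.
  have fN w : fglift f (- w) = - fglift f w by rewrite -sub0r subf f0 sub0r.
  by rewrite -[v in LHS]opprK subf fN opprK.
have f0 : fglift f 0 = 0 by apply: (addrI (fglift f 0)); rewrite -addf !addr0.
move=> a u v; rewrite addf; congr (_ + _).
rewrite -[u in RHS]freeg_sumE [_ *: u]/(fgscale a u) /fgscale.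
rewrite !(big_morph _ addf f0) scaler_sumr; apply: eq_bigr => x _.
by rewrite !liftU scalerA.
Qed.

HB.instance Definition _ (K : choiceType) (M : lmodType F) (f : K -> M) :=
  GRing.isLinear.Build F {freeg K / F} M *:%R (fglift f) (fglift_is_linear f).

Context (X : topologicalType).

HB.instance Definition _ n :=
  GRing.isLinear.Build F (chain R F X n.+1) (chain R F X n) *:%R
    (@boundary R F X n) (@fglift_is_linear _ _ _).

Definition gen n (s : continuousType (simplex R n) X) : chain R F X n :=
  << s >>.

Lemma fglift_gen (M : lmodType F) n
    (f : continuousType (simplex R n) X -> M) s : fglift f (gen s) = f s.
Proof. by rewrite liftU scale1r. Qed.

Lemma chain_ind n (P : set (chain R F X n)) : submodule P ->
  (forall s, P (gen s)) -> forall z, P z.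
Proof.
move=> subP Pgen z; rewrite -[z]freeg_sumE.
apply: submodule_sum => // s _.
have -> : << coeff s z *g s >> = coeff s z *: gen s :> chain R F X n.
  by apply/eqP/freeg_eqP => t; rewrite coeffZ !coeffU mul1r.
exact: submoduleZ.
Qed.

Lemma boundary_gen n (s : continuousType (simplex R n.+1) X) :
  boundary (gen s) = \sum_(i < n.+2) (-1) ^+ i *: gen (s \o face R i).
Proof. exact: fglift_gen. Qed.

Lemma boundary_edge (s : continuousType (simplex R 1) X) :
  boundary (gen s) = gen (s \o face R ord0) - gen (s \o face R ord_max).
Proof.
rewrite boundary_gen big_ord_recl big_ord1 expr0 scale1r expr1 scaleN1r.
by congr (_ - gen (_ \o face R _)); exact: val_inj.
Qed.

Lemma boundary_triangle (s : continuousType (simplex R 2) X) :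
  boundary (gen s) = gen (s \o face R ord0) - gen (s \o face R (lift ord0 ord0))
    + gen (s \o face R ord_max).
Proof.
rewrite boundary_gen !big_ord_recl big_ord0 addr0 expr0 scale1r expr1 scaleN1r.
rewrite sqrrN expr1n scale1r addrA.
by congr (_ + gen (_ \o face R _)); exact: val_inj.
Qed.

Definition bound1 : set (chain R F X 1) := range (@boundary R F X 1).

Lemma bound1_submodule : submodule bound1.
Proof.
split=> [|a _ _ [u _ <-] [v _ <-]]; first by exists 0; rewrite ?linear0.
by exists (a *: u + v); rewrite // linearP.
Qed.

Lemma cst_bound1 (s : continuousType (simplex R 1) X) (x : X) :
  (forall p, s p = x) -> bound1 (gen s).
Proof.
move=> sx; exists (gen (cst x : continuousType (simplex R 2) X)) => //.
rewrite boundary_triangle.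
have cE i : (cst x : continuousType (simplex R 2) X) \o face R i = s
    :> continuousType (simplex R 1) X.
  by apply/continuousEP => p /=; rewrite sx.
by rewrite !cE subrr add0r.
Qed.

End Chains.

Arguments gen {R} F {X n} s.
Arguments bound1 {R F X}.

(** * Homotopies of edges *)

Section Segments.
Context (R : realType) (F : fieldType) (X : topologicalType).

Section AffineSegments.
Context (E : normedModType R) (K : continuousType E X).
Implicit Types p q r : E.

Definition segment_vertices p q : 'I_2 -> E := tnth [tuple p; q].

Definition segment p q : continuousType (simplex R 1) X :=
  K \o affine (segment_vertices p q).

Lemma segmentE p q x :
  segment p q x = K (barycentric ord0 x *: p + barycentric ord_max x *: q).
Proof.
rewrite /segment /= affineE big_ord_recl big_ord1.
congr (K (_ *: _ + barycentric _ _ *: _)).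
exact: val_inj.
Qed.

Lemma segment_triangle p q r :
  bound1 (gen F (segment p r) - (gen F (segment p q) + gen F (segment q r))).
Proof.
rewrite -[_ - _]opprK; apply/(submoduleN (bound1_submodule _ _ _)).
exists (gen F (K \o affine (tnth [tuple p; q; r]) :
  continuousType (simplex R 2) X)) => //.
have faceE (i : 'I_3) (e : 'I_2 -> E) : tnth [tuple p; q; r] \o lift i = e ->
    (K \o affine (tnth [tuple p; q; r])) \o face R i = K \o affine e
      :> continuousType (simplex R 1) X.
  by move=> <-; apply/continuousEP => x /=; rewrite affine_face.
rewrite boundary_triangle opprB.
rewrite (faceE _ (segment_vertices q r)); last first.
  by apply/funext => -[[|[|//]] ?].
rewrite (faceE _ (segment_vertices p r)); last first.
  by apply/funext => -[[|[|//]] ?].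
rewrite (faceE _ (segment_vertices p q)); last first.
  by apply/funext => -[[|[|//]] ?].
by rewrite addrC addrA.
Qed.

End AffineSegments.

Definition interval_point (t : R) : simplex R 1 :=
  shrink (t, vertex R ord_max).

Lemma interval_point_continuous : continuous interval_point.
Proof.
move=> t; apply: (@continuous_comp _ _ _
  (fun u : R => (u, vertex R (ord_max : 'I_2))) (@shrink R 1));
  last exact: shrink_continuous.
by apply: continuous_pair => u; [exact: cvg_id|exact: cvg_cst].
Qed.

Lemma barycentric0_edge (x : simplex R 1) :
  barycentric ord0 x = 1 - barycentric ord_max x.
Proof.
rewrite -(barycentric_sum x) big_ord_recl big_ord1.
by rewrite (_ : lift ord0 ord0 = ord_max) ?addrK//; exact: val_inj.
Qed.

Lemma interval_pointK x : interval_point (barycentric ord_max x) = x.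
Proof.
have c1 : barycentric ord_max (interval_point (barycentric ord_max x)) =
    barycentric ord_max x.
  rewrite barycentric_shrink /= !barycentric_vertex eqxx mulr1 /= mulr0 add0r.
  by rewrite unit_clamp_id// barycentric_ge0 barycentric_le1.
apply: simplex_eq => i; have [->//|ne] := eqVneq i ord_max.
have -> : i = ord0 by apply: val_inj; case: i ne => [[|[|//]] ?].
by rewrite !barycentric0_edge c1.
Qed.

Definition track (H : continuousType (R * simplex R 1)%type X)
    (y : simplex R 1) : continuousType (simplex R 1) X.
Proof.
refine (mkcts (_ : continuous (fun x => H (barycentric ord_max x, y)))).
move=> x.
apply: (@continuous_comp _ _ _ (fun x => (barycentric ord_max x, y)) H).
  apply: continuous_pair => z; first exact: barycentric_continuous.
  exact: cst_continuous.
exact: cts_fun.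
Defined.

(** The domain of [H] is a square, the union of two triangles with the same
    diagonal; the difference of their boundaries is the boundary of the square.
    *)
Lemma prism_bound1 (H : continuousType (R * simplex R 1)%type X)
    (s0 s1 : continuousType (simplex R 1) X) :
  (forall x, H (0, x) = s0 x) -> (forall x, H (1, x) = s1 x) ->
  bound1 ((gen F s0 + gen F (track H (vertex R ord_max))) -
          (gen F (track H (vertex R ord0)) + gen F s1)).
Proof.
move=> H0 H1.
have Kc : continuous (fun p : R * R => H (p.1, interval_point p.2)).
  move=> p; apply: (@continuous_comp _ _ _
    (fun p : R * R => (p.1, interval_point p.2)) H); last exact: cts_fun.
  apply: continuous_pair => q; first exact: cvg_fst.
  by apply: continuous_comp; [exact: cvg_snd|exact: interval_point_continuous].
pose K : continuousType (R * R)%type X := mkcts Kc.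
have KE p : K p = H (p.1, interval_point p.2) by [].
have seg_eq (s : continuousType (simplex R 1) X) p q :
    (forall x, K (barycentric ord0 x *: p + barycentric ord_max x *: q) =
      s x) ->
    segment K p q = s.
  by move=> Ks; apply/continuousEP => x; rewrite segmentE Ks.
have lo := segment_triangle K (0, 0) (0, 1) (1, 1).
have hi := segment_triangle K (0, 0) (1, 0) (1, 1).
have e0 : segment K (0, 0) (0, 1) = s0.
  apply: seg_eq => x; rewrite KE /= /GRing.scale /= !mulr0 mulr1 !add0r H0.
  by rewrite interval_pointK.
have e1 : segment K (1, 0) (1, 1) = s1.
  apply: seg_eq => x; rewrite KE /= /GRing.scale /= !mulr0 !mulr1 add0r.
  rewrite barycentric0_edge subrK H1.
  by rewrite interval_pointK.
have t0 : segment K (0, 0) (1, 0) = track H (vertex R ord0).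
  apply: seg_eq => x; rewrite KE /= /GRing.scale /= !mulr0 mulr1 !add0r.
  by rewrite /interval_point shrink0.
have t1 : segment K (0, 1) (1, 1) = track H (vertex R ord_max).
  apply: seg_eq => x; rewrite KE /= /GRing.scale /= !mulr0 !mulr1 add0r.
  rewrite barycentric0_edge subrK.
  by rewrite /interval_point shrink1.
move: (submoduleB (bound1_submodule _ _ _) hi lo); rewrite e0 e1 t0 t1.
by rewrite opprB addrC subrKA.
Qed.

Lemma homotopic_rel_bound1 (H : continuousType (R * simplex R 1)%type X)
    (s0 s1 : continuousType (simplex R 1) X) :
  (forall x, H (0, x) = s0 x) -> (forall x, H (1, x) = s1 x) ->
  (forall t, H (t, vertex R ord0) = s0 (vertex R ord0)) ->
  (forall t, H (t, vertex R ord_max) = s0 (vertex R ord_max)) ->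
  bound1 (gen F s0 - gen F s1).
Proof.
move=> H0 H1 end0 end1; have := prism_bound1 H0 H1.
have subB := @bound1_submodule R F X.
have B0 : bound1 (gen F (track H (vertex R ord0))).
  by apply: cst_bound1 => p; exact: end0.
have B1 : bound1 (gen F (track H (vertex R ord_max))).
  by apply: cst_bound1 => p; exact: end1.
move=> /(submoduleD subB)/(_ (submoduleB subB B0 B1)).
rewrite addrC [gen F s0 + _]addrC -[_ + gen F s0 - _]addrA subrKA.
by rewrite addrCA opprD addNKr.
Qed.

Lemma homotopic_free_bound1 (H : continuousType (R * simplex R 1)%type X)
    (s0 s1 : continuousType (simplex R 1) X) :
  (forall x, H (0, x) = s0 x) -> (forall x, H (1, x) = s1 x) ->
  (forall t, H (t, vertex R ord0) = H (t, vertex R ord_max)) ->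
  bound1 (gen F s0 - gen F s1).
Proof.
move=> H0 H1 ends; have := prism_bound1 H0 H1.
have -> : track H (vertex R ord_max) = track H (vertex R ord0).
  by apply/continuousEP => x; exact/esym/ends.
by rewrite opprD addrA addrK.
Qed.

(** The straight-line homotopy in [R] from [u] to the affine map with the same
    ends, composed with [g], fixes the ends. *)
Lemma segment_straighten (g : continuousType R X) (u : simplex R 1 -> R)
    (s : continuousType (simplex R 1) X) : continuous u ->
  (forall x, g (u x) = s x) ->
  bound1 (gen F s -
    gen F (segment g (u (vertex R ord0)) (u (vertex R ord_max)))).
Proof.
move=> uc gu; set a := u (vertex R ord0); set b := u (vertex R ord_max).
pose v := affine (segment_vertices a b).
have v_cts : continuous v by exact: cts_fun.
have v0 : v (vertex R ord0) = a by rewrite affine_vertex.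
have v1 : v (vertex R ord_max) = b by rewrite affine_vertex.
have hc : continuous
    (fun p : R * simplex R 1 => (1 - p.1) * u p.2 + p.1 * v p.2).
  move=> p.
  have p1c : {for p, continuous (fun p : R * simplex R 1 => p.1)}.
    exact: cvg_fst.
  have u2c : {for p, continuous (fun p : R * simplex R 1 => u p.2)}.
    by apply: continuous_comp; [exact: cvg_snd|exact: uc].
  have v2c : {for p, continuous (fun p : R * simplex R 1 => v p.2)}.
    by apply: continuous_comp; [exact: cvg_snd|exact: v_cts].
  apply: cvgD; apply: cvgM => //.
  by apply: cvgB => //; exact: cvg_cst.
have Hc : continuous
    (fun p : R * simplex R 1 => g ((1 - p.1) * u p.2 + p.1 * v p.2)).
  move=> p; apply: (@continuous_comp _ _ _
    (fun p : R * simplex R 1 => (1 - p.1) * u p.2 + p.1 * v p.2) g);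
    [exact: hc|exact: cts_fun].
pose H : continuousType (R * simplex R 1)%type X := mkcts Hc.
have HE t x : H (t, x) = g ((1 - t) * u x + t * v x) by [].
apply: (@homotopic_rel_bound1 H) => [x|x|t|t]; rewrite HE.
- by rewrite subr0 mul1r mul0r addr0 gu.
- by rewrite subrr mul1r mul0r add0r.
- by rewrite v0 -/a -mulrDl subrK mul1r gu.
- by rewrite v1 -/b -mulrDl subrK mul1r gu.
Qed.

End Segments.

(** * First homology of a disjoint union of loops *)

Lemma simplex0_vertex (R : realType) (x : simplex R 0) : x = vertex R ord0.
Proof.
apply: simplex_eq => i; rewrite ord1 barycentric_vertex eqxx.
by rewrite -(barycentric_sum x) big_ord1.
Qed.

Section Loops.
Context (R : realType) (F : fieldType) (Y : topologicalType) (m : nat).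
Context (g : 'I_m -> continuousType R Y).
Hypothesis hausY : hausdorff_space Y.
Hypothesis loop_g : forall i, loop_param (g i).
Hypothesis disjoint_g : forall i j s t, g i s = g j t -> i = j.
Hypothesis cover_g : forall y, exists i t, g i t = y.

Definition lift_of n (s : continuousType (simplex R n) Y)
    (iu : 'I_m * (simplex R n -> R)) : Prop :=
  continuous iu.2 /\ forall x, g iu.1 (iu.2 x) = s x.

(** The loops are closed, disjoint and finite in number, hence open as well,
    and a simplex is connected. *)
Lemma simplex_in_loop n (s : continuousType (simplex R n) Y) :
  exists i, forall x, range (g i) (s x).
Proof.
have [i [t t_s]] := cover_g (s (vertex R ord0)); exists i.
pose A j := s @^-1` range (g j).
have Aclosed j : closed (A j).
  apply: preimage_closed => [x _|]; first exact: cts_fun.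
  exact: loop_range_closed.
have AC : A i = ~` \bigcup_(j in [set j | j != i]) A j.
  apply/seteqP; split=> x.
    move=> [a _ aE] [j /= ji [b _ bE]]; move: ji.
    by rewrite (@disjoint_g j i b a) ?eqxx// aE bE.
  move=> nA; have [j [b bE]] := cover_g (s x).
  have [<-|ji] := eqVneq j i; first by exists b.
  by exfalso; apply: nA; exists j => //; exists b.
apply: (@clopen_simplex _ _ (A i) (vertex R ord0)) => //; last by exists t.
rewrite AC; apply: closed_openC; apply: closed_bigcup => //.
exact: finite_finset.
Qed.

(** Contracting the simplex to a vertex gives a homotopy from a constant map,
    which has a constant lift. *)
Lemma lift_exists n (s : continuousType (simplex R n) Y) :
  exists iu, lift_of s iu.
Proof.
have [i si] := simplex_in_loop s.
have [t _ tE] := si (vertex R ord0).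
have Gc : continuous (fun p => s (@shrink R n p)).
  move=> p.
  apply: (@continuous_comp _ _ _ (@shrink R n) s); last exact: cts_fun.
  exact: shrink_continuous.
have [|||v [vc vE]] := @homotopy_lift _ _ _ hausY (loop_g i) _
  (fun p => s (@shrink R n p)) (cst t) (@simplex_compact R n) Gc.
- by move=> p; exact: si.
- by move=> x; exact: cst_continuous.
- by move=> x; rewrite shrink0 tE.
by exists (i, v); split=> //= x; rewrite vE shrink1.
Qed.

Lemma lift_unique n (s : continuousType (simplex R n) Y) i u j v :
  lift_of s (i, u) -> lift_of s (j, v) ->
  i = j /\ exists k : int, forall x, u x = v x + k%:~R.
Proof.
move=> [/= uc us] [/= vc vs].
have ij : i = j.
  apply: (@disjoint_g i j (u (vertex R ord0)) (v (vertex R ord0))).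
  by rewrite us vs.
split=> //; subst j.
have uv_int x : u x - v x \is a Num.int.
  by apply/(loop_g i).2; rewrite us vs.
have uvc : continuous (fun x => u x - v x).
  by move=> x; apply: (cvgB (FF := nbhs_filter x)); [exact: uc|exact: vc].
have /intrP[k kE] := uv_int (vertex R ord0).
exists k => x.
rewrite -kE (simplex_int_valued_cst uvc uv_int (vertex R ord0) x).
by rewrite addrC subrK.
Qed.

Definition chosen_lift n (s : continuousType (simplex R n) Y) :=
  projT1 (cid (lift_exists s)).

Lemma liftP n (s : continuousType (simplex R n) Y) : lift_of s (chosen_lift s).
Proof. exact: projT2 (cid (lift_exists s)). Qed.

Definition frac (t : R) : R := t - (Num.floor t)%:~R.

Definition loop_chain (i : 'I_m) : chain R F Y 1 := gen F (segment (g i) 0 1).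

(** The signed number of integers crossed by a lift, in the component of the
    loop that contains the simplex. All lifts give the same value by [lift_unique]. *)
Definition winding_gen (s : continuousType (simplex R 1) Y) : 'rV[F]_m :=
  (Num.floor ((chosen_lift s).2 (vertex R ord_max)) -
   Num.floor ((chosen_lift s).2 (vertex R ord0)))%:~R *:
    delta_mx 0 (chosen_lift s).1.

(** A path to [x] from the origin of its loop, along the parametrization. The
    fractional part makes the path independent of the lift of [x]. *)
Definition base_path_gen (x : continuousType (simplex R 0) Y) : chain R F Y 1 :=
  gen F (segment (g (chosen_lift x).1) 0
    (frac ((chosen_lift x).2 (vertex R ord0)))).

Definition winding : chain R F Y 1 -> 'rV[F]_m := fglift winding_gen.
Definition base_path : chain R F Y 0 -> chain R F Y 1 := fglift base_path_gen.

HB.instance Definition _ := GRing.isLinear.Build F (chain R F Y 1) 'rV[F]_m *:%R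
  winding (@fglift_is_linear _ _ _ _).
HB.instance Definition _ := GRing.isLinear.Build F
  (chain R F Y 0) (chain R F Y 1) *:%R base_path (@fglift_is_linear _ _ _ _).

Lemma winding_genE s i u : lift_of s (i, u) ->
  winding (gen F s) = (Num.floor (u (vertex R ord_max)) -
    Num.floor (u (vertex R ord0)))%:~R *: delta_mx 0 i.
Proof.
rewrite /winding fglift_gen /winding_gen; have := liftP s.
case: (chosen_lift s) => j v lv lu; have [-> [k vE]] := lift_unique lv lu => /=.
by rewrite !vE !floorDrz ?intr_int// opprD addrACA subrr addr0.
Qed.

Lemma base_path_genE x i u : lift_of x (i, u) ->
  base_path (gen F x) = gen F (segment (g i) 0 (frac (u (vertex R ord0)))).
Proof.
rewrite /base_path fglift_gen /base_path_gen; have := liftP x.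
case: (chosen_lift x) => j v lv lu; have [-> [k vE]] := lift_unique lv lu => /=.
rewrite /frac vE floorDrz ?intr_int// intrKfloor intrD.
by rewrite opprD addrACA subrr addr0.
Qed.

Lemma lift_of_face n (s : continuousType (simplex R n.+1) Y) i u j :
  lift_of s (i, u) -> lift_of (s \o face R j) (i, u \o face R j).
Proof.
move=> [/= uc us]; split=> /= [x|x]; last exact: us.
apply: continuous_comp; [exact: cts_fun|exact: uc].
Qed.

(** The three contributions telescope along a lift of the triangle. *)
Lemma winding_boundary w : winding (boundary w) = 0.
Proof.
apply: (@chain_ind _ _ _ _ [set w | winding (boundary w) = 0]) => [|s /=].
  split=> /= [|a u v u0 v0]; first by rewrite !linear0.
  by rewrite !linearP /= u0 v0 scaler0 addr0.
have [[i u] lu] := lift_exists s.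
rewrite boundary_triangle linearD linearB /=.
rewrite !(winding_genE (lift_of_face _ lu)) -scalerBl -scalerDl /= !face_vertex.
rewrite (_ : lift ord0 ord_max = ord_max); last exact: val_inj.
rewrite (_ : lift (lift ord0 ord0) ord_max = ord_max); last exact: val_inj.
rewrite (_ : lift (lift ord0 ord0) ord0 = ord0); last exact: val_inj.
rewrite (_ : lift ord_max ord_max = lift ord0 ord0); last exact: val_inj.
rewrite (_ : lift ord_max ord0 = ord0); last exact: val_inj.
set a := Num.floor _; set b := Num.floor _; set c := Num.floor _.
by rewrite -intrB -intrD (_ : _ + _ = 0) ?scale0r//; lia.
Qed.

Lemma loop_chain_winding i : winding (loop_chain i) = delta_mx 0 i.
Proof.
rewrite (@winding_genE _ i
  (affine (segment_vertices (0 : R) (1 : R)))); last first.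
  by split=> //=; exact: cts_fun.
by rewrite !affine_vertex /= floor1 floor0 subr0 scale1r.
Qed.

Lemma loop_chain_boundary i : boundary (loop_chain i) = 0.
Proof.
rewrite boundary_edge; apply/eqP; rewrite subr_eq0; apply/eqP.
congr gen; apply/continuousEP => x /=.
rewrite (simplex0_vertex x) !face_vertex.
rewrite (_ : lift ord0 ord0 = ord_max); last exact: val_inj.
rewrite (_ : lift ord_max ord0 = ord0); last exact: val_inj.
by rewrite !affine_vertex; apply/(loop_g i).2; rewrite subr0 rpred1.
Qed.

Lemma segment_shift i k a b : k \is a Num.int ->
  segment (g i) (k + a) (k + b) = segment (g i) a b.
Proof.
move=> k_int; apply/continuousEP => x; rewrite !segmentE; apply/(loop_g i).2.
rewrite !scalerDr addrACA -scalerDl barycentric0_edge subrK scale1r addrK//.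
Qed.

Lemma segment_int i (k : int) :
  bound1 (gen F (segment (g i) 0 k%:~R) - k%:~R *: loop_chain i).
Proof.
have step (l : int) : bound1 (gen F (segment (g i) 0 (l + 1)%:~R) -
    (gen F (segment (g i) 0 l%:~R) + loop_chain i)).
  rewrite /loop_chain -(@segment_shift i l%:~R 0 1) ?intr_int// addr0 -intrD1.
  exact: segment_triangle.
have subB := @bound1_submodule R F Y.
elim/int_rect: k => [|n IH|n IH].
- rewrite scale0r subr0; apply: (@cst_bound1 _ _ _ _ (g i 0)) => x.
  by rewrite segmentE !scaler0 addr0.
- rewrite (_ : Posz n.+1 = n%:Z + 1); last by lia.
  apply: (submodule_trans subB (step n)).
  by rewrite intrD1 scalerDl scale1r opprD addrACA subrr addr0.
- have := step (- n.+1%:Z); rewrite (_ : - n.+1%:Z + 1 = - n%:Z); last by lia.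
  move=> T_S.
  apply: (submodule_trans subB
    (v := gen F (segment (g i) 0 (- n%:Z)%:~R) - loop_chain i)).
    by rewrite opprB addrA -opprB; apply: submoduleN.
  rewrite (_ : - n.+1%:Z = - n%:Z - 1); last by lia.
  by rewrite intrB scalerBl scale1r opprB subrKA.
Qed.

Lemma segment_frac i t : bound1 (gen F (segment (g i) 0 t) -
  (gen F (segment (g i) 0 (frac t)) + (Num.floor t)%:~R *: loop_chain i)).
Proof.
have subB := @bound1_submodule R F Y; set k := Num.floor t.
have tri := segment_triangle F (g i) 0 k%:~R t.
apply: (submodule_trans subB tri).
have -> : segment (g i) k%:~R t = segment (g i) 0 (frac t).
  rewrite -(@segment_shift i k%:~R 0 (frac t)) ?intr_int// addr0.
  by rewrite /frac -/k addrC subrK.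
by rewrite [X in X - _]addrC opprD addrACA subrr add0r; exact: segment_int.
Qed.

(** For one edge: straighten its lift, replace the segment from [u0] to [u1] by
    the difference of the segments from 0, and split off the integer parts,
    which are multiples of the loop. *)
Lemma loop_decomposition z : bound1 (z -
  (base_path (boundary z) + \sum_i winding z 0 i *: loop_chain i)).
Proof.
have subB := @bound1_submodule R F Y.
pose D z := base_path (boundary z) + \sum_i winding z 0 i *: loop_chain i.
have D_lin a u v : D (a *: u + v) = a *: D u + D v.
  rewrite /D !linearP /= scalerDr addrACA; congr (_ + _).
  rewrite scaler_sumr -big_split; apply: eq_bigr => i _ /=.
  by rewrite !mxE scalerDl scalerA.
have D0 : D 0 = 0.
  rewrite /D !linear0 add0r big1// => i _; by rewrite mxE scale0r.
apply: (@chain_ind _ _ _ _ [set z | bound1 (z - D z)]).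
  split=> [|a u v uB vB] /=; first by rewrite D0 subr0; exact: submodule0 subB.
  by rewrite D_lin opprD addrACA -scalerBr; exact: subB.2.
move=> s /=; rewrite /D; have [[i u] lu] := lift_exists s.
rewrite (winding_genE lu) boundary_edge linearB /=.
rewrite !(base_path_genE (lift_of_face _ lu)).
rewrite /= !face_vertex (bigD1 i)//= big1 => [|j ji]; last first.
  by rewrite !mxE eqxx (negPf ji) mulr0 scale0r.
rewrite !mxE !eqxx mulr1 addr0.
rewrite (_ : lift ord0 ord0 = ord_max); last exact: val_inj.
rewrite (_ : lift ord_max ord0 = ord0); last exact: val_inj.
have [/= uc us] := lu.
apply: (submodule_trans subB (segment_straighten F uc us)).
set u0 := u (vertex R ord0); set u1 := u (vertex R ord_max).
apply: (submodule_trans subB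
  (v := gen F (segment (g i) 0 u1) - gen F (segment (g i) 0 u0))).
  rewrite -[X in bound1 X]opprB; apply: (submoduleN subB).
  have := segment_triangle F (g i) 0 u0 u1; by rewrite opprD addrA.
have := submoduleB subB (segment_frac i u1) (segment_frac i u0).
have subrACA (V : zmodType) (a b x y : V) : (a - x) - (b - y) = a - b - (x - y).
  by rewrite !opprB addrACA (addrC (- x)) addrACA.
by rewrite subrACA => frac_B; rewrite intrB scalerBl addrACA -opprD.
Qed.

End Loops.

Section Functoriality.
Context (R : realType) (F : fieldType) (X Y : topologicalType).
Context (f : continuousType Y X).

HB.instance Definition _ n :=
  GRing.isLinear.Build F (chain R F Y n) (chain R F X n) *:%R
    (@chain_map R F Y X f n) (@fglift_is_linear _ _ _ _).

Lemma chain_map_gen n (s : continuousType (simplex R n) Y) :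
  chain_map f (gen F s) = gen F (f \o s).
Proof. exact: fglift_gen. Qed.

Lemma chain_map_boundary n (z : chain R F Y n.+1) :
  boundary (chain_map f z) = chain_map f (boundary z).
Proof.
apply: (@chain_ind _ _ _ _ [set z | boundary (chain_map f z) =
  chain_map f (boundary z)]) => [|s /=].
  split=> /= [|a u v u0 v0]; first by rewrite !linear0.
  by rewrite !linearP /= u0 v0.
rewrite chain_map_gen !boundary_gen linear_sum; apply: eq_bigr => i _.
by rewrite linearZ /= chain_map_gen; congr (_ *: gen F _); exact/continuousEP.
Qed.

Lemma chain_map_bound1 (z : chain R F Y 1) : bound1 z -> bound1 (chain_map f z).
Proof.
by move=> [w _ <-]; exists (chain_map f w) => //; exact: chain_map_boundary.
Qed.

Lemma chain_map_segment (E : normedModType R) (K : continuousType E Y) p q :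
  chain_map f (gen F (segment K p q)) = gen F (segment (f \o K) p q).
Proof. by rewrite chain_map_gen; congr gen; exact/continuousEP. Qed.

End Functoriality.

(** The linear relations between the classes of the loops in [H_1(X; F)]. *)
Definition loop_relations (R : realType) (F : fieldType) (X : topologicalType) n
    (g : 'I_n -> continuousType R X) : set 'rV[F]_n :=
  [set a | bound1 (\sum_i a 0 i *: gen F (segment (g i) 0 1))].

Arguments loop_relations {R} F {X n} g.

Lemma loop_relations_submodule (R : realType) (F : fieldType)
    (X : topologicalType) n (g : 'I_n -> continuousType R X) :
  submodule (loop_relations F g).
Proof.
have subB := @bound1_submodule R F X.
split=> [|a u v uB vB]; rewrite /loop_relations /=.
  by rewrite big1 => [|i _]; [exact: submodule0 subB|rewrite mxE scale0r].
rewrite (_ : \sum_i _ = a *: (\sum_i u 0 i *: gen F (segment (g i) 0 1)) +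
  \sum_i v 0 i *: gen F (segment (g i) 0 1)); first exact: subB.2.
rewrite scaler_sumr -big_split; apply: eq_bigr => i _ /=.
by rewrite !mxE scalerDl scalerA.
Qed.

(** A cycle is homologous to the combination of the loops given by its winding
    numbers, so it dies in [X] exactly if these numbers are the coefficients of
    a relation between the images of the loops. *)
Theorem H1_kernel_rank_loops (R : realType) (F : fieldType)
    (X Y : topologicalType) (f : continuousType Y X) m
    (g : 'I_m -> continuousType R Y) :
  hausdorff_space Y -> (forall i, loop_param (g i)) ->
  (forall i j s t, g i s = g j t -> i = j) ->
  (forall y, exists i t, g i t = y) ->
  H1_kernel_rank R F f = subspace_dim (loop_relations F (fun i => f \o g i)).
Proof.
move=> hausY loop_g disjoint_g cover_g.
have f_comb a : chain_map f (\sum_i a i *: loop_chain F g i) =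
    \sum_i a i *: gen F (segment (f \o g i) 0 1).
  rewrite linear_sum; apply: eq_bigr => i _.
  by rewrite linearZ /= chain_map_segment.
apply: (@quotient_dim_transfer F (chain R F Y 1) _ _ m (loop_chain F g)
  (winding hausY loop_g disjoint_g cover_g)
  (loop_relations F (fun i => f \o g i))) => /=.
- exact: bound1_submodule.
- exact: loop_relations_submodule.
- by move=> _ [w _ <-]; exact: winding_boundary.
- exact: loop_chain_winding.
- move=> z [z0 fz].
  have := loop_decomposition hausY loop_g disjoint_g cover_g z.
  rewrite z0 linear0 add0r => zB; split=> //.
  rewrite /loop_relations /= -f_comb.
  have := submoduleB (bound1_submodule _ _ _) fz (chain_map_bound1 f zB).
  by rewrite linearB opprB addrCA subrr addr0.
- move=> a aW; split; last by rewrite f_comb.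
  rewrite linear_sum big1// => i _.
  by rewrite linearZ /= loop_chain_boundary// scaler0.
Qed.

(** * Kernel ranks of states *)

Lemma injective_hausdorff (X Y : topologicalType) (f : Y -> X) :
  hausdorff_space X -> continuous f -> injective f -> hausdorff_space Y.
Proof.
move=> hausX fc finj x y xy; apply/finj/hausX => A B xA yB.
by have [z [Az Bz]] := xy _ _ (fc x _ xA) (fc y _ yB); exists (f z).
Qed.

Lemma continuous_comp_within (T U V : topologicalType) (A : set U) (f : T -> U)
    (h : U -> V) :
  continuous f -> (forall x, A (f x)) -> {within A, continuous h} ->
  continuous (h \o f).
Proof.
move=> fc fA /subspace_continuousP hc x W Wh.
have hW : nbhs (f x) [set y | A y -> W (h y)] := hc (f x) (fA x) W Wh.
have fW : nbhs x [set y | A (f y) -> W (h (f y))] := fc x _ hW.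
suff : nbhs x [set y | W (h (f y))] by [].
by apply: filterS fW => y; apply; exact: fA.
Qed.

Section LoopHomotopy.
Context (R : realType) (F : fieldType) (X : topologicalType).

(** Contractions and isotopies are both homotopies of this kind; the end [g1]
    is a constant for the first and the moved loop for the second. *)
Lemma loop_homotopy_bound1 (H : R -> X -> X) (C : set X)
    (g g1 : continuousType R X) :
  {within `[0, 1] `*` C, continuous (fun q : R * X => H q.1 q.2)} ->
  (forall x, C x -> H 0 x = x) ->
  (forall s, C (g s)) -> g 0 = g 1 -> (forall s, H 1 (g s) = g1 s) ->
  bound1 (gen F (segment g 0 1) - gen F (segment g1 0 1)).
Proof.
move=> Hc H0 gC g01 H1.
pose e := affine (segment_vertices (0 : R) (1 : R)).
pose track_fun (q : R * simplex R 1) := (unit_clamp q.1, g (e q.2)).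
have track_cts : continuous track_fun.
  apply: continuous_pair => q.
    by apply: continuous_comp; [exact: cvg_fst|exact: unit_clamp_continuous].
  apply: (@continuous_comp _ _ _ snd (g \o e)); first exact: cvg_snd.
  exact: cts_fun.
have Kc : continuous ((fun q : R * X => H q.1 q.2) \o track_fun).
  apply: continuous_comp_within Hc => // q; split; last exact: gC.
  by rewrite /= in_itv /=; exact: unit_clamp_itv.
pose K : continuousType (R * simplex R 1)%type X := mkcts Kc.
have KE t x : K (t, x) = H (unit_clamp t) (g (e x)) by [].
apply: (@homotopic_free_bound1 _ _ _ K) => [x|x|t]; rewrite KE.
- by rewrite unit_clamp_id ?lexx ?ler01// H0.
- by rewrite unit_clamp_id ?lexx ?ler01// H1.
- by rewrite KE !affine_vertex /= g01.
Qed.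

Lemma contractible_bound1 (g : continuousType R X) : loop_param g ->
  contractible R (range g) -> bound1 (gen F (segment g 0 1)).
Proof.
move=> [_ g_eq] [H [p [Hc H0 H1]]].
have cst_B : bound1 (gen F (segment (cst p : continuousType R X) 0 1)).
  exact: (@cst_bound1 _ _ _ _ p).
rewrite -[gen F _](subrK (gen F (segment (cst p : continuousType R X) 0 1))).
apply: (submoduleD (@bound1_submodule R F X)) => //.
apply: (loop_homotopy_bound1 Hc) => //.
- by apply/g_eq; rewrite sub0r rpredN rpred1.
- by move=> s; apply: H1; exists s.
Qed.

End LoopHomotopy.

Lemma loop_relations_homologous (R : realType) (F : fieldType)
    (X : topologicalType) n (g g1 : 'I_n -> continuousType R X) :
  (forall i, bound1 (gen F (segment (g i) 0 1) - gen F (segment (g1 i) 0 1))) ->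
  loop_relations F g = loop_relations F g1.
Proof.
move=> gg1; have subB := @bound1_submodule R F X.
apply/funext => a; rewrite /loop_relations /=.
set u := \sum_i _; set v := \sum_i _.
have uv : bound1 (u - v).
  rewrite -sumrB; apply: (submodule_sum subB) => i _.
  by rewrite -scalerBr; apply: submoduleZ.
apply/propext; split=> [uB|vB].
  by rewrite -[v](subKr u); apply: submoduleB.
by rewrite -[u](subrK v); apply: submoduleD.
Qed.

Definition numbers_loops (R : realType) (X : topologicalType) n
    (p : 'I_n -> continuousType R X) (L : set (set X)) : Prop :=
  [/\ forall i, loop_param (p i),
      injective (fun i => range (p i))
    & forall C, L C <-> exists i, range (p i) = C].

Lemma loops_numbering (R : realType) (X : topologicalType) (L : set (set X)) :
  finite_set L -> (forall C, L C -> simple_loop R C) ->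
  exists p : 'I_#|` fset_set L|%fset -> continuousType R X, numbers_loops p L.
Proof.
move=> finL simL; set n := #|` _|%fset.
pose C (i : 'I_n) := nth set0 (fset_set L) i.
have CL i : L (C i).
  have : C i \in fset_set L by apply: mem_nth; exact: ltn_ord.
  by rewrite in_fset_set// inE.
have /choice[p pP] i :
    exists g : continuousType R X, loop_param g /\ range g = C i.
  by have [g [gc g_eq gC]] := simL _ (CL i); exists (mkcts gc); split.
exists p; split=> [i|i j|D].
- by have [] := pP i.
- have [_ ->] := pP i; have [_ ->] := pP j => /eqP.
  rewrite nth_uniq ?ltn_ord ?fset_uniq// => /eqP; exact: val_inj.
- split=> [LD|[i <-]]; last by have [_ ->] := pP i.
  have D_in : D \in fset_set L by rewrite in_fset_set// inE.
  have iP : (index D (fset_set L) < n)%N by rewrite index_mem.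
  exists (Ordinal iP); have [_ ->] := pP (Ordinal iP).
  exact: nth_index.
Qed.

Section States.
Context (R : realType) (Sigma : oriented_surface R) (D : link_diagram Sigma).

(** The dimension depends on the noncontractible loops only through their
    parametrizations [p], which are free to be chosen: this allows two states
    with isotopic noncontractible loops to be compared. *)
Lemma kernel_rank_split (S : state D) n (p : 'I_n -> continuousType R Sigma) :
  numbers_loops p (noncontractible_loops S) ->
  kernel_rank S =
    (subspace_dim (loop_relations 'F_2 p) + num_contractible S)%N.
Proof.
move=> [p_loop p_inj pL].
have finite_contr : finite_set [set C | loops S C /\ contractible R C].
  by apply: sub_finite_set (loops_finite S) => C [].
have simple_contr C :
    [set C | loops S C /\ contractible R C] C -> simple_loop R C.
  by move=> [SC _]; exact: loops_simple SC.
have [q [q_loop q_inj qL]] := loops_numbering finite_contr simple_contr.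
rewrite /num_contractible.
set t := #|` _|%fset in q q_loop q_inj qL *.
pose h (k : 'I_(n + t)) : continuousType R Sigma :=
  match fintype.split k with inl i => p i | inr j => q j end.
have h_loop k : loop_param (h k) by rewrite /h; case: fintype.split.
have h_S k : loops S (range (h k)).
  rewrite /h; case: fintype.split => [i|j].
    by have /pL[] : exists i', range (p i') = range (p i) by exists i.
  by have /qL[] : exists j', range (q j') = range (q j) by exists j.
have S_h C : loops S C -> exists k, range (h k) = C.
  move=> SC; have [cC|ncC] := pselect (contractible R C).
    have /qL[j <-] : [set C | loops S C /\ contractible R C] C by [].
    by exists (rshift n j); rewrite /h (unsplitK (inr j)).
  have /pL[i <-] : noncontractible_loops S C by [].
  by exists (lshift t i); rewrite /h (unsplitK (inl i)).
have h_inj k l a b : h k a = h l b -> k = l.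
  move=> hab.
  have : range (h k) = range (h l).
    apply: (loops_disjoint (h_S k) (h_S l)).
    by exists (h k a); split; [exists a|exists b].
  rewrite -[k]fintype.splitK -[l]fintype.splitK.
  case: (fintype.split k) (fintype.split l) => [i|i] [j|j];
    rewrite /h !unsplitK.
  - by move=> /p_inj ->.
  - move=> pq; have /pL[_] : exists i', range (p i') = range (p i) by exists i.
    rewrite pq.
    by have /qL[] : exists j', range (q j') = range (q j) by exists j.
  - move=> qp; have /pL[_] : exists i', range (p i') = range (p j) by exists j.
    rewrite -qp.
    by have /qL[] : exists j', range (q j') = range (q i) by exists i.
  - by move=> /q_inj ->.
set A := \bigcup_(C in loops S) C.
have hA k s : h k s \in A.
  by apply/mem_set; exists (range (h k)) => //; exists s.
pose hY_fun k s : set_type A := exist _ (h k s) (hA k s).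
have hY_cts k : continuous (hY_fun k).
  by apply: continuous_comp_initial; exact: cts_fun.
pose hY k : continuousType R (set_type A) := mkcts (@hY_cts k).
have hYE k : inclusion A \o hY k = h k :> continuousType R Sigma.
  exact/continuousEP.
have hY_val k s : set_val (hY k s) = h k s by [].
rewrite /kernel_rank (@H1_kernel_rank_loops _ _ _ _ (inclusion A) _ hY).
- apply: quotient_dim_free; first exact: loop_relations_submodule.
  move=> a; rewrite /loop_relations /= big_split_ord /=.
  set u := \sum_i _; set v := \sum_i _; set w := \sum_i _.
  have uw : u = w.
    apply: eq_bigr => i _; rewrite hYE mxE; congr (_ *: gen _ (segment _ _ _)).
    by rewrite /h (unsplitK (inl i)).
  have vB : bound1 v.
    apply: submodule_sum => [|j _]; first exact: bound1_submodule.
    apply: submoduleZ; first exact: bound1_submodule.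
    rewrite hYE /h (unsplitK (inr j)); apply: contractible_bound1 => //.
    by have /qL[] : exists j', range (q j') = range (q j) by exists j.
  have subB := @bound1_submodule R 'F_2 Sigma.
  rewrite uw; split=> [uvB|wB]; last exact: submoduleD.
  by rewrite -[w](addrK v); apply: submoduleB.
- apply: (injective_hausdorff (@surface_hausdorff R Sigma) (f := set_val)).
    exact: initial_continuous.
  exact: val_inj.
- move=> k; split=> [|s s']; first exact: cts_fun.
  rewrite -(h_loop k).2 -!hY_val; split=> [->//|]; exact: val_inj.
- move=> k l s s' /(congr1 set_val); exact: h_inj.
- move=> y; have /= [C SC Cy] := set_valP y.
  have [k kC] := S_h _ SC; move: Cy; rewrite -kC => -[s _ sE].
  by exists k, s; apply: val_inj.
Qed.

End States.

Theorem homologically_adequate_is_adequate (R : realType)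
    (Sigma : oriented_surface R) (D : link_diagram Sigma) m :
  homologically_adequate D m -> adequate D m.
Proof.
move=> hom Sm S Sm_all adj.
have [iso|] := pselect (isotopic R (noncontractible_loops S)
  (noncontractible_loops Sm)); last by right.
left.
have fin_nc : finite_set (noncontractible_loops S).
  by apply: sub_finite_set (loops_finite S) => C [].
have simple_nc C : noncontractible_loops S C -> simple_loop R C.
  by move=> [SC _]; exact: loops_simple SC.
have [p pS] := loops_numbering fin_nc simple_nc.
have [p_loop p_inj pL] := pS.
have [H [Hc Hhomeo H0 HL]] := iso.
have I1 : `[0, 1]%classic (1 : R) by rewrite /= in_itv /= ler01 lexx.
have [h' [Hc1 _ HK _]] := Hhomeo 1 I1.
have H_inj := can_inj HK.
have imK (B : set Sigma) : h' @` (H 1 @` B) = B.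
  by rewrite image_comp (_ : h' \o H 1 = id) ?image_id//; apply/funext.
(* The loops of [Sm] are parametrized by the isotoped loops of [S], so that the
   two families of classes agree term by term. *)
pose p' i : continuousType R Sigma :=
  (mkcts Hc1 : continuousType Sigma Sigma) \o p i.
have p'E i s : p' i s = H 1 (p i s) by [].
have range_p' i : range (p' i) = H 1 @` range (p i) by rewrite image_comp.
have p'S : numbers_loops p' (noncontractible_loops Sm).
  split=> [i|i j|C].
  - split=> [|s t]; first exact: cts_fun.
    by rewrite -(p_loop i).2 !p'E; split=> [/H_inj|->].
  - rewrite !range_p' => eq_im; apply: p_inj.
    by rewrite -[LHS]imK eq_im imK.
  - rewrite -HL; split=> [[B /pL[i <-] <-]|[i <-]].
      by exists i; exact: range_p'.
    by exists (range (p i)); [apply/pL; exists i|rewrite range_p'].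
have rel : loop_relations 'F_2 p = loop_relations 'F_2 p'.
  apply: loop_relations_homologous => i.
  apply: (@loop_homotopy_bound1 R 'F_2 Sigma H setT (p i) (p' i) Hc) => //.
  by apply/(p_loop i).2; rewrite sub0r rpredN rpred1.
have := hom _ _ Sm_all adj.
by rewrite (kernel_rank_split pS) (kernel_rank_split p'S) rel leq_add2l.
Qed.

Theorem proposition8 (R : realType) (Sigma : oriented_surface R)
  (D : link_diagram Sigma) :
  (homologically_adequate D Asmoothing -> adequate D Asmoothing) /\
  (homologically_adequate D Bsmoothing -> adequate D Bsmoothing).
Proof. by split; exact: homologically_adequate_is_adequate. Qed.
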